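(* There is an absolute constant $C$ such that for every odd integer $p\ge 3$ and every $k\in\mathbb{Z}_p$, the block walk on $\mathbb{Z}_p$ associated with the Pollard Rho walk with parameter $k$ has mixing time in separation distance satisfying $$\tau_s(1/2)\le C\,\log p\,\log\log p .$$
   Context: Block walk: the Pollard Rho walk with parameter $k$ on $\mathbb{Z}_p$ moves at each step from $i$ to $i+1$, to $i+k$, or to $2i$ (all modulo $p$), each with probability $1/3$ (probabilities of coinciding targets are added). A single step of the block walk consists of running the Pollard Rho walk until and including its next doubling move $i\to 2i$. Equivalently, the block walk is the Markov chain $Z_i=2(Z_{i-1}+b_i)$ on $\mathbb{Z}_p$, where $b_1,b_2,\ldots$ are i.i.d. $\mathbb{Z}_p$-valued random variables, $b_i$ being the sum of $N$ independent increments each equal to $1$ or $k$ with probability $1/2$, with $N$ independent of the increments and $\Pr[N=n]=\frac13(2/3)^n$ for $n=0,1,2,\ldots$. Its stationary distribution $\pi$ is uniform on $\mathbb{Z}_p$. For a Markov chain with transition matrix $P$ on a finite state space $V$ and stationary distribution $\pi$, the mixing time in separation distance is $$\tau_s(\epsilon)=\min\Bigl\{n:\ \forall x,y\in V,\ 1-\frac{P^n(x,y)}{\pi(y)}\le\epsilon\Bigr\}.$$ Logarithms are natural. *)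

(* Defs.v *)
From HB Require Import structures.
From mathcomp Require Import all_boot all_order all_algebra.
From mathcomp Require Import all_classical all_reals all_analysis.

Set Implicit Arguments.
Unset Strict Implicit.
Unset Printing Implicit Defensive.

Import Order.TTheory GRing.Theory Num.Theory.
Import numFieldNormedType.Exports.

Local Open Scope ring_scope.

(* Pr[N = n] *)
Definition run_length_prob (R : realType) (n : nat) : R := 3^-1 * (2 / 3) ^+ n.

(* Probability that n independent increments, each equal to 1 or k with
   probability 1/2, sum to b. The choices are indexed by bool, not by their
   values, so that probabilities add up when k = 1. *)
Definition increment_sum_prob (R : realType) (p : nat) (k : 'Z_p) (n : nat)
    (b : 'Z_p) : R :=
  #|[set w : {ffun 'I_n -> bool} |
      \sum_(i < n) (if w i then 1 else k) == b]|%:R / 2 ^+ n.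

(* Pr[b_1 = b], by conditioning on N. The terms are nonnegative and bounded by
   those of a geometric series, so the limit is a genuine one. *)
Definition block_increment_prob (R : realType) (p : nat) (k b : 'Z_p) : R :=
  limn (series (fun n => run_length_prob R n * increment_sum_prob R k n b)).

(* Transition matrix of Z_i = 2 (Z_(i-1) + b_i). 'Z_p is by definition the
   ordinal type 'I_(Zp_trunc p).+2, so its elements index the matrix; it is the
   ring of integers modulo p only when 1 < p. *)
Definition block_walk (R : realType) (p : nat) (k : 'Z_p) :
    'M[R]_((Zp_trunc p).+2) :=
  \matrix_(x, y)
    \sum_(b : 'Z_p | 2 * (x + b) == y) block_increment_prob R k b.

Definition uniform_distr (R : realType) (p : nat) (x : 'Z_p) : R := p%:R^-1.

Definition separated_within (R : realType) (m : nat) (P : 'M[R]_m)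
    (pi : 'I_m -> R) (eps : R) (n : nat) : Prop :=
  forall x y : 'I_m, 1 - (P ^+ n) x y / pi y <= eps.

(* t = tau_s(eps). A relation rather than a function, so that the existence of
   the minimum has to be established and no default value is involved. *)
Definition is_sep_mixing_time (R : realType) (m : nat) (P : 'M[R]_m)
    (pi : 'I_m -> R) (eps : R) (t : nat) : Prop :=
  separated_within P pi eps t /\
  forall n : nat, separated_within P pi eps n -> (t <= n)%N.

(* Main.v *)
Require Import Defs.
From HB Require Import structures.
From mathcomp Require Import all_boot all_order all_algebra.
From mathcomp Require Import all_classical all_reals all_analysis.
From mathcomp Require Import complex ring lra zify.

Set Implicit Arguments.
Unset Strict Implicit.
Unset Printing Implicit Defensive.

Import Order.TTheory GRing.Theory Num.Theory.
Import numFieldNormedType.Exports.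
Import Normc.

Local Open Scope ring_scope.

(** The characters of Z_p are permuted by the block walk up to a factor: it maps
    z |-> e(xi z) to q(2 xi) e(2 xi x), where q is the characteristic function
    of one block increment. Hence p P^n(x, y) - 1 is bounded by the sum over
    xi <> 0 of the product of |q(2^j xi)| for 1 <= j <= n. Now |q(xi)| <= 17/18
    when xi / p lies in [1/4, 3/4] modulo 1, and 2^j xi / p does so exactly when
    the binary digits j+1 and j+2 of xi / p differ. The first digit and the
    digit changes among the first L ~ log2 p positions determine xi, so a window
    of length L in which each digit change costs d contributes at most
    2 ((1 + d)^L - 1). Cutting n = r L steps into r windows and applying AM-GM
    gives this bound with d = (17/18)^r, which is at most 1/2 as soon as
    r is a large multiple of log L ~ log log p. *)

(** * Law of one block increment *)

Section BlockIncrement.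

Variables (R : realType) (p : nat) (k : 'Z_p).

Lemma run_length_prob_ge0 n : 0 <= run_length_prob R n.
Proof. by rewrite mulr_ge0 ?exprn_ge0 ?divr_ge0 ?invr_ge0. Qed.

Lemma series_run_length_cvg :
  (series (run_length_prob R) x @[x --> \oo] --> (1 : R))%classic.
Proof.
have lt1 : `|2 / 3 : R| < 1 by rewrite ger0_norm; lra.
have := cvg_geometric_series (a := 3^-1) lt1.
suff -> : 3^-1 / (1 - 2 / 3) = 1 :> R by [].
by field.
Qed.

Lemma increment_sum_prob_ge0 n b : 0 <= increment_sum_prob R k n b.
Proof. by rewrite divr_ge0 ?exprn_ge0. Qed.

Lemma sum_increment_sum_prob n : \sum_b increment_sum_prob R k n b = 1.
Proof.
rewrite -mulr_suml -natr_sum.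
have <- : #|{ffun 'I_n -> bool}| =
    (\sum_(b : 'Z_p) #|[set w : {ffun 'I_n -> bool} |
       (\sum_(i < n) (if w i then 1 else k))%R == b]|)%N.
  rewrite -sum1_card (partition_big (fun w : {ffun 'I_n -> bool} =>
    \sum_(i < n) (if w i then 1 else k)) xpredT) //=.
  by apply: eq_bigr => b _; rewrite sum1dep_card.
by rewrite card_ffun card_bool card_ord natrX divff // expf_neq0.
Qed.

Lemma increment_sum_prob_le1 n b : increment_sum_prob R k n b <= 1.
Proof.
rewrite -(sum_increment_sum_prob n) (bigD1 b) //= lerDl sumr_ge0 // => c _.
exact: increment_sum_prob_ge0.
Qed.

Let term b n := run_length_prob R n * increment_sum_prob R k n b.

Let term_ge0 b n : 0 <= term b n.
Proof.
by rewrite mulr_ge0 ?run_length_prob_ge0 ?increment_sum_prob_ge0.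
Qed.

Lemma block_increment_series_cvg b : cvgn (series (term b)).
Proof.
apply: series_le_cvg (term_ge0 b) run_length_prob_ge0 _ _ => [n|].
  by rewrite ler_piMr ?run_length_prob_ge0 ?increment_sum_prob_le1.
by apply/cvg_ex; exists 1; exact: series_run_length_cvg.
Qed.

Lemma block_increment_prob_ge b n :
  series (term b) n <= block_increment_prob R k b.
Proof.
apply: (@nondecreasing_cvgn_le R (series (term b))) => //.
  by apply: nondecreasing_series => m _ _; exact: term_ge0.
exact: block_increment_series_cvg.
Qed.

Lemma block_increment_prob_ge0 b : 0 <= block_increment_prob R k b.
Proof. by have := block_increment_prob_ge b 0; rewrite /series /= big_geq. Qed.

(** Summed over [b], the partial series become the geometric partial sums of [run_length_prob]; a
    finite sum commutes with the limit. *)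
Lemma sum_block_increment_prob : \sum_b block_increment_prob R k b = 1.
Proof.
have cvgS : (\sum_b series (term b) x @[x --> \oo]
             --> \sum_b block_increment_prob R k b)%classic.
  apply: cvg_big => [|b _]; first exact: add_continuous.
  exact: block_increment_series_cvg.
apply: (cvg_unique _ cvgS) => //.
suff -> : (fun n => \sum_b series (term b) n) = series (run_length_prob R).
  exact: series_run_length_cvg.
apply/funext => n; rewrite /series /= exchange_big /=; apply: eq_bigr => i _.
by rewrite -mulr_sumr sum_increment_sum_prob mulr1.
Qed.

(** The empty run alone puts mass 1/3 at 0. *)
Lemma block_increment_prob0 : 3^-1 <= block_increment_prob R k 0.
Proof.
apply: le_trans (block_increment_prob_ge 0 1).
rewrite /series /= big_nat1 /term /run_length_prob /increment_sum_prob.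
rewrite !expr0 divr1 mulr1 ler_peMr ?invr_ge0 // ler1n card_gt0.
by apply/set0Pn; exists [ffun=> true]; rewrite inE big_ord0.
Qed.

(** A run has length 1 with probability 2/9, and its increment is then 1 with probability at least
    1/2. *)
Lemma block_increment_prob1 : 9^-1 <= block_increment_prob R k 1.
Proof.
apply: le_trans (block_increment_prob_ge 1 2).
rewrite /series /= big_nat_recl // big_nat1 -[leLHS]add0r lerD ?term_ge0 //.
rewrite /term /run_length_prob /increment_sum_prob !expr1.
suff : (1 : R) <= #|[set w : {ffun 'I_1 -> bool} |
      \sum_(i < 1) (if w i then 1 else k) == 1]|%:R by lra.
rewrite ler1n card_gt0; apply/set0Pn; exists [ffun=> true].
by rewrite inE big_ord1 ffunE.
Qed.

End BlockIncrement.

(** * Binary digits of residues *)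

Section BinaryExpansion.

Variable p' : nat.
Local Notation p := p'.+2.
Implicit Types x y : 'Z_p.

(* x / p lies in [1/4, 3/4] modulo 1. For p odd this says that the first two
   binary digits of x / p differ. *)
Definition mid_quarters x := (p <= 4 * x <= 3 * p)%N.

Lemma ltn_Zp x : (x < p)%N. Proof. exact: ltn_ord. Qed.

Lemma val_Zp_opp x : x != 0 -> nat_of_ord (- x) = (p - x)%N.
Proof.
rewrite -val_eqE /= -lt0n => x0; apply: modn_small.
by have : (x < p)%N := ltn_Zp x; move: x0; rewrite /Zp_trunc /=; lia.
Qed.

Lemma val_Zp_double x :
  nat_of_ord (2 * x) = (if 2 * x < p then 2 * x else 2 * x - p)%N.
Proof.
have -> : nat_of_ord (2 * x) = ((x + x) %% p)%N by rewrite mulr_natl mulr2n.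
have : (x < p)%N := ltn_Zp x; move: (nat_of_ord x) => n ltnp.
case: ifP => lt2; first by rewrite modn_small; lia.
by rewrite -(subnK (_ : p <= n + n)%N) ?modnDr ?modn_small; lia.
Qed.

Lemma mid_quartersN x : x != 0 -> mid_quarters (- x) = mid_quarters x.
Proof.
move=> x0; have ltxp := ltn_Zp x; rewrite /mid_quarters val_Zp_opp //.
by lia.
Qed.

(** [p < 2 * x] is the first binary digit of x / p, and doubling shifts the digits. Oddness of p
    excludes the ties 2x = p and 4x = p. *)
Lemma second_digit x :
  odd p -> (p < 2 * (2 * x)%R)%N = ((p < 2 * x)%N (+) mid_quarters x).
Proof.
move=> oddp; have ltxp := ltn_Zp x; rewrite /mid_quarters val_Zp_double.
by case: ifP; lia.
Qed.

(* Equal digits keep x - y, read as an integer, doubling at each step. *)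
Lemma digits_inj L x y : odd p -> (p <= 2 ^ L)%N ->
  (p < 2 * x)%N = (p < 2 * y)%N ->
  (forall j, (j < L)%N ->
     mid_quarters (2 ^+ j * x) = mid_quarters (2 ^+ j * y)) ->
  x = y.
Proof.
move=> oddp ltpL dig0 mids.
(* The second equation says that the residues of 2^j x and 2^j y differ by 2^j (x - y), with the
   subtractions moved across. *)
have diff j : (j <= L)%N ->
    (p < 2 * (2 ^+ j * x)%R)%N = (p < 2 * (2 ^+ j * y)%R)%N /\
    ((2 ^+ j * x)%R + 2 ^ j * y = (2 ^+ j * y)%R + 2 ^ j * x)%N.
  elim: j => [|j IHj] ltjL; first by rewrite !expr0 !mul1r; split=> //; lia.
  have [digj dj] := IHj (ltnW ltjL).
  rewrite !exprS -!mulrA !second_digit // mids // digj; split=> //.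
  rewrite !val_Zp_double expnS.
  have := ltn_Zp (2 ^+ j * x); have := ltn_Zp (2 ^+ j * y).
  move: dj digj oddp; rewrite -!mulnA.
  move: (2 ^ j * y)%N (2 ^ j * x)%N => A B.
  move: (nat_of_ord (2 ^+ j * x)) (nat_of_ord (2 ^+ j * y)) => X Y.
  by do 2!case: ifP; lia.
(* If x and y were distinct, two residues below p would now differ by at least 2^L >= p. *)
have [_ dL] := diff L (leqnn L).
have ltxL := ltn_Zp (2 ^+ L * x); have ltyL := ltn_Zp (2 ^+ L * y).
apply/val_inj; case: (ltngtP x y) => // ltxy.
- by have := leq_mul (leqnn (2 ^ L)%N) ltxy; rewrite mulnS; lia.
- by have := leq_mul (leqnn (2 ^ L)%N) ltxy; rewrite mulnS; lia.
Qed.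

(** Without a digit change, x has the digits of 0 if its first digit is 0; otherwise -x does, since
    negation flips the first digit and preserves the changes. *)
Lemma exists_mid_quarters L x : odd p -> (p <= 2 ^ L)%N -> x != 0 ->
  exists2 j, (j < L)%N & mid_quarters (2 ^+ j * x).
Proof.
move=> oddp ltpL x0.
suff /existsP[j midj] : [exists j : 'I_L, mid_quarters (2 ^+ j * x)].
  by exists j.
apply: contraT; rewrite negb_exists => /forallP /= nomid.
have mid0 j : mid_quarters (2 ^+ j * 0) = false.
  by rewrite mulr0 /mid_quarters muln0.
have [ltpx|lexp] := boolP (p < 2 * x)%N; last first.
  have := @digits_inj L x 0 oddp ltpL; rewrite muln0 ltn0 => H.
  case/eqP: x0; apply: H => [|j ltjL]; first exact/negbTE.
  by rewrite mid0; apply/negbTE; apply: (nomid (Ordinal ltjL)).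
have Nx0 : - x != 0 by rewrite oppr_eq0.
have := @digits_inj L (- x) 0 oddp ltpL; rewrite muln0 ltn0 => H.
case/eqP: Nx0; apply: H => [|j ltjL].
  have ltxp := ltn_Zp x; rewrite val_Zp_opp //.
  by apply/negbTE; move: ltpx; lia.
rewrite mid0 mulrN; have [->|xj0] := eqVneq (2 ^+ j * x) 0.
  by rewrite oppr0 -(mulr0 (2 ^+ j)) mid0.
by rewrite mid_quartersN //; apply/negbTE; apply: (nomid (Ordinal ltjL)).
Qed.

(** Nonzero residues inject into the pairs of a first digit and a nonempty set of digit changes.
    Over all such pairs the sum factorises: 2 for the first digit, 1 + d per position, minus the
    empty set. *)
Lemma sum_prod_mid_quarters (R : realFieldType) (d : R) L :
  odd p -> (p <= 2 ^ L)%N -> 0 <= d ->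
  \sum_(x : 'Z_p | x != 0)
     \prod_(j < L) (if mid_quarters (2 ^+ j * x) then d else 1)
  <= 2 * ((1 + d) ^+ L - 1).
Proof.
move=> oddp ltpL d0.
pose F (f : {ffun 'I_L -> bool}) := \prod_j (if f j then d else 1).
have F0 f : 0 <= F f by apply: prodr_ge0 => j _; case: ifP.
pose code (x : 'Z_p) : bool * {ffun 'I_L -> bool} :=
  ((p < 2 * x)%N, [ffun j : 'I_L => mid_quarters (2 ^+ j * x)]).
have code_inj : injective code.
  move=> x y [dig0 /ffunP mids]; apply: (digits_inj oddp ltpL dig0) => j ltjL.
  by have := mids (Ordinal ltjL); rewrite !ffunE.
have -> : 2 * ((1 + d) ^+ L - 1) =
    \sum_(c : bool * {ffun 'I_L -> bool} | c.2 != [ffun=> false]) F c.2.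
  rewrite -(pair_big_dep xpredT (fun _ f => f != [ffun=> false])
    (fun _ f => F f)) /= sumr_const card_bool mulr_natl; congr (_ *+ _).
  have -> : (1 + d) ^+ L = \sum_f F f.
    rewrite -(bigA_distr_bigA
      (fun (_ : 'I_L) (b : bool) => if b then d else 1)).
    by rewrite prodr_const card_ord big_bool addrC.
  rewrite (bigD1 [ffun=> false]) //=.
  have -> : F [ffun=> false] = 1 by apply: big1 => j _; rewrite ffunE.
  by rewrite [1 + _]addrC addrK.
have -> : \sum_(x : 'Z_p | x != 0)
     \prod_(j < L) (if mid_quarters (2 ^+ j * x) then d else 1) =
   \sum_(c in [set code x | x in [set x : 'Z_p | x != 0]]) F c.2.
  rewrite big_imset /=; last by move=> ? ? _ _ /code_inj.
  under [RHS]eq_bigl do rewrite inE.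
  by apply: eq_bigr => x _; apply: eq_bigr => j _; rewrite ffunE.
(* Pairs that come from no nonzero residue only add nonnegative terms. *)
rewrite [leRHS](bigID (mem [set code x | x in [set x : 'Z_p | x != 0]])) /=.
rewrite -[leLHS]addr0 lerD ?sumr_ge0 // le_eqVlt; apply/orP; left; apply/eqP.
apply: eq_bigl => c; rewrite andb_idl // => /imsetP[x]; rewrite inE => x0 ->.
have [j ltjL midj] := exists_mid_quarters oddp ltpL x0.
by apply/eqP => /ffunP/(_ (Ordinal ltjL)); rewrite !ffunE midj.
Qed.

End BinaryExpansion.

(** * Additive characters of Z_p *)

Section Characters.

Variables (R : realType) (p' : nat).
Local Notation p := p'.+2.
Implicit Types x y : 'Z_p.

Lemma normc_ge0 (z : R[i]) : 0 <= normc z.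
Proof. by case: z => a b; exact: sqrtr_ge0. Qed.

Lemma normcD (z w : R[i]) : normc (z + w) <= normc z + normc w.
Proof. exact: le_normcD. Qed.

Lemma normc_sum (I : Type) (r : seq I) (P : pred I) (F : I -> R[i]) :
  normc (\sum_(i <- r | P i) F i) <= \sum_(i <- r | P i) normc (F i).
Proof.
elim/big_ind2: _ => [|u a v b leu lev|//]; first by rewrite normc0.
exact: le_trans (normcD a b) (lerD leu lev).
Qed.

Lemma normc_prod (I : Type) (r : seq I) (P : pred I) (F : I -> R[i]) :
  normc (\prod_(i <- r | P i) F i) = \prod_(i <- r | P i) normc (F i).
Proof. exact: (big_morph _ (@normcM R) (@normc1 R)). Qed.

Lemma normc_real (a : R) : normc a%:C%C = `|a|.
Proof. by rewrite /= expr0n addr0 sqrtr_sqr. Qed.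

Let theta : R := 2 * pi / p%:R.

Definition zeta : R[i] := (cos theta +i* sin theta)%C.

Lemma zetaX n : zeta ^+ n = (cos (n%:R * theta) +i* sin (n%:R * theta))%C.
Proof.
elim: n => [|n IHn]; first by rewrite expr0 mul0r cos0 sin0.
rewrite exprS IHn -natr1 mulrDl mul1r addrC cosD sinD.
by apply/eqP; rewrite eq_complex /=; apply/andP; split; apply/eqP; ring.
Qed.

Lemma zetaXp : zeta ^+ p = 1.
Proof.
rewrite zetaX /theta mulrC divfK ?pnatr_eq0 // mulr_natl cos2pi sin2pi.
by [].
Qed.

Lemma zetaX_neq1 n : (0 < n < p)%N -> zeta ^+ n != 1.
Proof.
move=> /andP[n0 ltnp]; rewrite zetaX eq_complex /= negb_and; apply/orP; left.
have p0 : 0 < p%:R :> R by rewrite ltr0n.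
(* The half angle lies strictly between 0 and pi, so its sine is positive and the double-angle
   formula keeps the real part below 1. *)
have -> : n%:R * theta = (n%:R / p%:R * pi) *+ 2.
  by rewrite /theta -mulr_natl; ring.
have : 0 < sin (n%:R / p%:R * pi : R).
  apply: sin_gt0_pi; rewrite mulr_gt0 ?divr_gt0 ?ltr0n ?pi_gt0 //=.
  by rewrite gtr_pMl ?pi_gt0 // ltr_pdivrMr // mul1r ltr_nat.
rewrite cos_mulr2n => s0; have := cos2Dsin2 (n%:R / p%:R * pi : R).
by move=> cs; apply/eqP => c1; nra.
Qed.

Definition char_Zp x : R[i] := zeta ^+ x.

Lemma char_Zp0 : char_Zp 0 = 1. Proof. by []. Qed.

Lemma char_ZpD x y : char_Zp (x + y) = char_Zp x * char_Zp y.
Proof. by rewrite /char_Zp /= (expr_mod _ zetaXp) exprD. Qed.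

Lemma char_Zp_neq1 x : x != 0 -> char_Zp x != 1.
Proof. by rewrite -val_eqE /= -lt0n => x0; rewrite zetaX_neq1 // x0 /=. Qed.

(** Shifting y by 1 multiplies the sum by [char_Zp x], which is not 1 for x nonzero; hence the sum
    vanishes. *)
Lemma sum_char_Zp x : \sum_(y : 'Z_p) char_Zp (y * x) = p%:R *+ (x == 0).
Proof.
have [->|x0] := eqVneq x 0.
  under eq_bigr do rewrite mulr0.
  by rewrite sumr_const card_ord mulr1n.
apply/eqP; rewrite mulr0n -(mulIr_eq0 _ (mulIf (_ : char_Zp x - 1 != 0))).
  rewrite mulrBr mulr1 subr_eq0; apply/eqP.
  rewrite mulr_suml [RHS](reindex (fun y : 'Z_p => y + 1)) /=.
    by apply: eq_bigr => y _; rewrite mulrDl mul1r char_ZpD.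
  by exists (fun y => y - 1) => y _; rewrite (addrK, subrK).
by rewrite subr_eq0 char_Zp_neq1.
Qed.

Lemma normc_char_Zp x : normc (char_Zp x) = 1.
Proof. by rewrite /char_Zp zetaX /= cos2Dsin2 sqrtr1. Qed.

(** The angle t has cos t <= 0, so the squared modulus 2 + 2 cos t is at most 2 < (3/2)^2. *)
Lemma normc_1D_char_Zp x : mid_quarters x -> normc (1 + char_Zp x) <= 3 / 2.
Proof.
rewrite /mid_quarters => /andP[le1 le2]; rewrite /char_Zp zetaX /= add0r.
set t := _ * theta.
have c0 : cos t <= 0.
  have p0 : 0 < p%:R :> R by rewrite ltr0n.
  have pi0 := pi_gt0 R.
  have le1R : p%:R <= 4 * x%:R :> R by rewrite -natrM ler_nat.
  have le2R : 4 * x%:R <= 3 * p%:R :> R by rewrite -!natrM ler_nat.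
  have -> : cos t = - cos (t - pi) by rewrite -[in LHS](subrK pi t) cosDpi.
  rewrite oppr_le0; apply: cos_ge0_pihalf.
  have -> : t - pi = (2 * x%:R / p%:R - 1) * pi by rewrite /t /theta; ring.
  have l1 : 2^-1 <= 2 * x%:R / p%:R :> R by rewrite ler_pdivlMr //; lra.
  have l2 : 2 * x%:R / p%:R <= 3 / 2 :> R by rewrite ler_pdivrMr //; lra.
  by move: (2 * x%:R / p%:R) l1 l2 => w l1 l2; apply/andP; split; nra.
have cs := cos2Dsin2 t.
rewrite -(@ler_pXn2r _ 2) ?nnegrE ?sqrtr_ge0 ?divr_ge0 // sqr_sqrtr.
  by nra.
by rewrite addr_ge0 ?sqr_ge0.
Qed.

End Characters.

(** * Fourier analysis of the block walk *)

Section BlockWalk.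

Variables (R : realType) (p' : nat) (k : 'Z_p'.+2).
Local Notation p := p'.+2.
Implicit Types x y z b : 'Z_p.

Let q b := block_increment_prob R k b.

Definition increment_char x : R[i] := \sum_b (q b)%:C%C * char_Zp R (b * x).

Lemma increment_char0 : increment_char 0 = 1.
Proof.
rewrite /increment_char; under eq_bigr do rewrite mulr0 char_Zp0 mulr1.
by rewrite -rmorph_sum sum_block_increment_prob.
Qed.

Lemma normc_increment_char x : normc (increment_char x) <= 1.
Proof.
apply: le_trans (normc_sum _ _ _) _.
rewrite -(sum_block_increment_prob R k) ler_sum // => b _.
rewrite normcM normc_real normc_char_Zp mulr1 ger0_norm //.
exact: block_increment_prob_ge0.
Qed.

(** The value 17/18 is 7/9 + (1/9)(3/2): mass 7/9 is estimated trivially, mass 1/9 at each of 0 and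
    1 by [normc_1D_char_Zp]. *)
Definition mid_contraction x : R := if mid_quarters x then 17 / 18 else 1.

Lemma mid_contraction_ge0 x : 0 <= mid_contraction x.
Proof. by rewrite /mid_contraction; case: ifP => // _; rewrite divr_ge0. Qed.

(* A mass 1/9 at each of 0 and 1 is split off: its characteristic function
   (1 + char_Zp x) / 9 is small when char_Zp x is far from 1. *)
Lemma normc_increment_char_mid x :
  normc (increment_char x) <= mid_contraction x.
Proof.
rewrite /mid_contraction; case: ifP => [midx|_];
  last exact: normc_increment_char.
pose d b : R := (b == 0)%:R / 9 + (b == 1)%:R / 9.
have sumd (f : 'Z_p -> R[i]) :
    \sum_b (d b)%:C%C * f b = 9^-1%:C%C * (f 0 + f 1).
  have sum1 a : \sum_b ((b == a)%:R / 9)%:C%C * f b = 9^-1%:C%C * f a.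
    rewrite (bigD1 a) // eqxx mul1r big1; first exact: addr0.
    by move=> b /negbTE->; rewrite !mul0r.
  by under eq_bigr do rewrite rmorphD mulrDl; rewrite big_split !sum1 mulrDr.
have qd0 b : 0 <= q b - d b.
  rewrite subr_ge0 /d; have [->|b0] := eqVneq b 0.
    by have := block_increment_prob0 R k; rewrite -/(q 0) eq_sym oner_eq0 /=;
    lra.
  have [->|b1] := eqVneq b 1.
    by have := block_increment_prob1 R k; rewrite -/(q 1) /=; lra.
  by rewrite !mul0r addr0 block_increment_prob_ge0.
have sumqd : \sum_b (q b - d b) = 7 / 9.
  (* The mass 2/9 of [d] is [sumd] at the constant function 1, hence the passage to complex
     numbers. *)
  rewrite sumrB sum_block_increment_prob; apply: complexI.
  have := sumd (fun=> 1); under eq_bigr do rewrite mulr1.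
  rewrite -rmorph_sum rmorphB => ->.
  rewrite -[1 + 1]/(2%:R) -(rmorph_nat (real_complex R)).
  by rewrite -rmorphM -rmorphB; congr (_%:C)%C; field.
have -> : increment_char x =
   \sum_b (q b - d b)%:C%C * char_Zp R (b * x) + 9^-1%:C%C * (1 + char_Zp R x).
  have := sumd (fun b => char_Zp R (b * x)); rewrite mul0r mul1r char_Zp0 => <-.
  rewrite -big_split; apply: eq_bigr => b _ /=.
  by rewrite -mulrDl -rmorphD subrK.
have -> : 17 / 18 = 7 / 9 + 9^-1 * (3 / 2) :> R by field.
apply: le_trans (normcD _ _) (lerD _ _); last first.
  by rewrite normcM normc_real ger0_norm // ler_wpM2l // normc_1D_char_Zp.
rewrite -sumqd; apply: le_trans (normc_sum _ _ _) _; apply: ler_sum => b _.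
by rewrite normcM normc_real normc_char_Zp mulr1 ger0_norm.
Qed.

Local Notation P := (block_walk R k).

Lemma block_walk_char x y :
  \sum_z (P x z)%:C%C * char_Zp R (y * z) =
  char_Zp R (2 * y * x) * increment_char (2 * y).
Proof.
under eq_bigr do rewrite mxE rmorph_sum mulr_suml.
rewrite (exchange_big_dep xpredT) //= mulr_sumr; apply: eq_bigr => b _.
rewrite (big_pred1 (2 * (x + b))) => [|z]; last exact: eq_sym.
rewrite [RHS]mulrCA -char_ZpD; congr (_ * char_Zp R _).
by ring.
Qed.

(** Induction splitting off the first step: the other n steps turn frequency y into 2^n y, and the
    first step then adds the factor at 2^(n+1) y. *)
Lemma block_walkX_char n x y :
  \sum_z ((P ^+ n) x z)%:C%C * char_Zp R (y * z) =
  char_Zp R (2 ^+ n * y * x) * \prod_(j < n) increment_char (2 ^+ j.+1 * y).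
Proof.
elim: n x => [|n IHn] x.
  rewrite big_ord0 !mul1r mulr1 (bigD1 x) //= big1 ?addr0 => [|z zx].
    by rewrite mxE eqxx mul1r.
  by rewrite mxE eq_sym (negbTE zx) mul0r.
have -> : \sum_z ((P ^+ n.+1) x z)%:C%C * char_Zp R (y * z) =
    \sum_z (P x z)%:C%C * \sum_w ((P ^+ n) z w)%:C%C * char_Zp R (y * w).
  under eq_bigr do rewrite exprS mxE rmorph_sum mulr_suml.
  rewrite exchange_big; apply: eq_bigr => z _; rewrite mulr_sumr.
  by apply: eq_bigr => w _; rewrite rmorphM mulrA.
under eq_bigr do rewrite IHn mulrA.
by rewrite -mulr_suml block_walk_char big_ord_recr /= !mulrA -exprS mulrAC.
Qed.

(** Fourier inversion: by orthogonality, summing over z retains only the end point y. *)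
Lemma block_walkX_fourier n x y :
  p%:R * ((P ^+ n) x y)%:C%C =
  \sum_z char_Zp R (- (z * y)) * (char_Zp R (2 ^+ n * z * x) *
    \prod_(j < n) increment_char (2 ^+ j.+1 * z)).
Proof.
under eq_bigr do rewrite -block_walkX_char mulr_sumr.
rewrite exchange_big (bigD1 y) //= [X in _ + X]big1 ?addr0 => [|w wy].
  under eq_bigr do rewrite mulrCA -char_ZpD addNr char_Zp0 mulr1.
  by rewrite sumr_const card_ord mulr_natl.
under eq_bigr do rewrite mulrCA -char_ZpD addrC -mulrBr.
by rewrite -mulr_sumr sum_char_Zp subr_eq0 (negbTE wy) mulr0n mulr0.
Qed.

(** Frequency 0 contributes exactly 1, the uniform part; elsewhere the characters have modulus 1. *)
Lemma block_walkX_dist n x y :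
  `|p%:R * (P ^+ n) x y - 1| <=
  \sum_(z : 'Z_p | z != 0) \prod_(j < n) mid_contraction (2 ^+ j.+1 * z).
Proof.
rewrite -normc_real rmorphB rmorph1 rmorphM rmorph_nat block_walkX_fourier.
rewrite (bigD1 0) //= mul0r oppr0 mulr0 mul0r char_Zp0 !mul1r.
have -> : \prod_(j < n) increment_char (2 ^+ j.+1 * 0) = 1.
  by apply: big1 => j _; rewrite mulr0 increment_char0.
rewrite [1 + _]addrC addrK; apply: le_trans (normc_sum _ _ _) _.
apply: ler_sum => z _; rewrite !normcM !normc_char_Zp !mul1r normc_prod.
by apply: ler_prod => j _; rewrite normc_increment_char_mid normc_ge0.
Qed.

End BlockWalk.

(** * AM-GM, splitting into blocks, and a Bernoulli-type bound *)

Lemma prod_le_mean (R : realFieldType) r (E : 'I_r -> R) : (0 < r)%N ->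
  (forall i, 0 <= E i) -> \prod_i E i <= (\sum_i E i ^+ r) / r%:R.
Proof.
move=> r0 E0; have Er0 i : 0 <= E i ^+ r by rewrite exprn_ge0.
(* AM-GM for the powers [E i ^+ r] bounds the r-th power of the product; then take r-th roots. *)
have := (@leif_AGM _ _ predT (fun i => E i ^+ r) (fun i _ => Er0 i)).1.
rewrite prodrXl cardT size_enum_ord ler_pXn2r ?nnegrE //.
  exact: prodr_ge0.
by rewrite divr_ge0 ?sumr_ge0.
Qed.

Lemma prod_blocks (R : comNzRingType) r L (f : nat -> R) :
  \prod_(j < r * L) f j = \prod_(i < r) \prod_(j < L) f (i * L + j)%N.
Proof.
elim: r => [|r IHr]; first by rewrite mul0n !big_ord0.
by rewrite big_ord_recr /= -IHr mulSnr big_split_ord.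
Qed.

(** Division-free form of (1 + d)^L <= 1 / (1 - L d); each step uses (1 + d)(1 - (L + 1) d) <= 1 - L
    d. *)
Lemma bernoulli_exp_bound (R : realFieldType) (d : R) L : 0 <= d ->
  (1 + d) ^+ L * (1 - L%:R * d) <= 1.
Proof.
move=> d0; elim: L => [|L IHL]; first by rewrite expr0 mul0r subr0 mulr1.
apply: le_trans IHL; rewrite exprSr -mulrA ler_wpM2l ?exprn_ge0 ?addr_ge0 //.
rewrite -natr1; have : 0 <= L%:R :> R by [].
by move: L%:R => l l0; nra.
Qed.

(** * Separation after r blocks of L steps *)

Section Separation.

Variables (R : realType) (p' : nat) (k : 'Z_p'.+2).
Local Notation p := p'.+2.
Hypothesis oddp : odd p.

Lemma unit2X m : (2 ^+ m : 'Z_p) \is a GRing.unit.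
Proof. by rewrite unitrX // unitZpE // coprimen2. Qed.

(** Since p is odd, multiplication by 2^m permutes the nonzero residues. *)
Lemma reindex_double (m : nat) (F : 'Z_p -> R) :
  \sum_(x : 'Z_p | x != 0) F (2 ^+ m * x) = \sum_(x : 'Z_p | x != 0) F x.
Proof.
have u := unit2X m.
rewrite [RHS](reindex (fun x : 'Z_p => 2 ^+ m * x)) /=.
  apply: eq_bigl => x; congr negb; apply/eqP/eqP => [->|];
    first by rewrite mulr0.
  by rewrite -[in X in X -> _](mulr0 (2 ^+ m)) => /(mulrI u).
by exists (fun x => (2 ^+ m)^-1 * x) => x _; rewrite (mulKr u, mulVKr u).
Qed.

(* The r blocks of L consecutive factors are permuted copies of each other, so
   AM-GM bounds the sum of products by a single block raised to the power r. *)
Lemma sum_prod_mid_contraction r L : (0 < r)%N -> (p <= 2 ^ L)%N ->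
  \sum_(z : 'Z_p | z != 0)
     \prod_(j < r * L) mid_contraction R (2 ^+ j.+1 * z)
  <= 2 * ((1 + (17 / 18) ^+ r) ^+ L - 1).
Proof.
move=> r0 ltpL.
pose G (z : 'Z_p) : R := \prod_(j < L) mid_contraction R (2 ^+ j * z).
have G0 z : 0 <= G z by apply: prodr_ge0 => j _; exact: mid_contraction_ge0.
apply: (@le_trans _ _ (\sum_(z : 'Z_p | z != 0)
    (\sum_(i < r) G (2 ^+ (i * L).+1 * z) ^+ r) / r%:R)).
  apply: ler_sum => z _.
  rewrite (prod_blocks r L (fun j => mid_contraction R (2 ^+ j.+1 * z))).
  apply: le_trans (prod_le_mean r0 (fun i => G0 _)).
  rewrite le_eqVlt; apply/orP; left; apply/eqP; apply: eq_bigr => i _.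
  by apply: eq_bigr => j _; rewrite mulrA -exprD addnS addnC.
rewrite -mulr_suml exchange_big /=.
under eq_bigr => i _ do rewrite (reindex_double _ (fun z => G z ^+ r)).
rewrite sumr_const card_ord -[_ *+ r]mulr_natr mulfK ?pnatr_eq0 -?lt0n //.
apply: le_trans (sum_prod_mid_quarters oddp ltpL _); last first.
  by rewrite exprn_ge0 ?divr_ge0.
apply: ler_sum => z _; rewrite -prodrXl le_eqVlt; apply/orP; left; apply/eqP.
by apply: eq_bigr => j _; rewrite /mid_contraction; case: ifP; rewrite ?expr1n.
Qed.

(** With d = (17/18)^r, the condition L d <= 1/5 gives (1 + d)^L <= 5/4, hence 2 ((1 + d)^L - 1) <=
    1/2. *)
Lemma separated_within_half r L : (0 < r)%N -> (p <= 2 ^ L)%N ->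
  L%:R * (17 / 18) ^+ r <= 5^-1 :> R ->
  separated_within (block_walk R k) (@uniform_distr R p) (1 / 2) (r * L).
Proof.
move=> r0 ltpL leLr x y; rewrite /uniform_distr invrK [_ * p%:R]mulrC.
rewrite -opprB; apply: le_trans (ler_norm _) _; rewrite normrN.
apply: le_trans (block_walkX_dist R k _ x y) _.
apply: le_trans (sum_prod_mid_contraction r0 ltpL) _.
have d0 : 0 <= (17 / 18) ^+ r :> R by rewrite exprn_ge0 ?divr_ge0.
have := bernoulli_exp_bound L d0.
have : 0 <= (1 + (17 / 18) ^+ r) ^+ L :> R by rewrite exprn_ge0 // addr_ge0.
by nra.
Qed.

Lemma is_sep_mixing_time_exists n :
  separated_within (block_walk R k) (@uniform_distr R p) (1 / 2) n ->
  exists2 t, is_sep_mixing_time (block_walk R k) (@uniform_distr R p) (1 / 2) t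
    & (t <= n)%N.
Proof.
move=> sepn; pose sep m := `[< separated_within (block_walk R k)
  (@uniform_distr R p) (1 / 2) m >].
have exsep : exists m, sep m by exists n; exact/asboolP.
have [t /asboolP sept mint] := ex_minnP exsep.
by exists t; [split=> // m sepm; apply: mint; exact/asboolP
             | apply: mint; exact/asboolP].
Qed.

End Separation.

(** * Numerical bounds on logarithms *)

Section Logarithms.

Variable R : realType.

Lemma ln2_ge : 2^-1 <= ln 2 :> R.
Proof.
have : ln (1 - 2^-1) <= - 2^-1 :> R by apply: le_ln1Dx; lra.
rewrite (_ : 1 - 2^-1 = 2^-1 :> R); last by field.
by rewrite lnV ?posrE // lerN2.
Qed.

(** This makes ln ln p positive from p = 3 on. It follows from exp(-1) >= (9/10)^10 > 1/3. *)
Lemma ln3_gt1 : 1 < ln 3 :> R.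
Proof.
have e10 : 9 / 10 <= expR (- 10^-1) :> R.
  by apply: le_trans (expR_ge1Dx _); lra.
have : (9 / 10) ^+ 10 <= expR (- 1) :> R.
  rewrite (_ : - 1 = 10%:R * - 10^-1 :> R); last by field.
  by rewrite expRM_natl lerXn2r // nnegrE ?divr_ge0 ?expR_ge0.
rewrite !exprS expr0 => le9.
have : 3^-1 < expR (- 1) :> R by lra.
by rewrite -ltr_ln ?posrE ?expR_gt0 // expRK lnV ?posrE // ltrN2.
Qed.

Lemma up_log2_le n : (1 < n)%N -> (up_log 2 n)%:R <= 1 + 2 * ln n%:R :> R.
Proof.
move=> n1; have n0 : 0 < n%:R :> R by rewrite ltr0n ltnW.
have u0 : (0 < up_log 2 n)%N by rewrite up_log_gt0.
have : 2 ^+ (up_log 2 n).-1 <= n%:R :> R.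
  by rewrite -natrX ler_nat ltnW // up_log_gtn.
rewrite -ler_ln ?posrE ?exprn_gt0 // lnXn // -[ln 2 *+ _]mulr_natr.
have -> : (up_log 2 n)%:R = 1 + (up_log 2 n).-1%:R :> R.
  by rewrite -[in LHS](prednK u0) -natr1 addrC.
have : 2^-1 * (up_log 2 n).-1%:R <= ln 2 * (up_log 2 n).-1%:R :> R.
  by rewrite ler_wpM2r // ln2_ge.
by lra.
Qed.

End Logarithms.

Theorem mainTheorem2 (R : realType) :
  exists C : R, forall (p : nat) (k : 'Z_p), odd p -> (3 <= p)%N ->
    exists2 t : nat,
      is_sep_mixing_time (block_walk R k) (@uniform_distr R p) (1 / 2) t
      & t%:R <= C * ln p%:R * ln (ln p%:R).
Proof.
have ln3 := ln3_gt1 R.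
have ll3 : 0 < ln (ln 3) :> R by rewrite ln_gt0.
(* The quotient by ln ln 3 absorbs additive constants into a multiple of ln ln p; 48 is 16 from r =
   16 s times 3 from L <= 3 ln p. *)
pose K : R := 2 + (1 + 2 * ln 24) / ln (ln 3).
exists (48 * K) => p k oddp le3p.
(* As (17/18)^16 <= 1/2, taking r = 16 s with 2^s >= 8 L gives L (17/18)^r <= 1/8, below the
   required 1/5. *)
pose L := up_log 2 p; pose s := up_log 2 (8 * L).
have L0 : (0 < L)%N by rewrite up_log_gt0 /= ltnW.
have s0 : (0 < s)%N by rewrite up_log_gt0 /=; lia.
have ltpL : (p <= 2 ^ L)%N by exact: up_logP.
have sL : (8 * L <= 2 ^ s)%N by exact: up_logP.
have half16 : (17 / 18) ^+ 16 <= 2^-1 :> R.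
  by rewrite !exprS expr0; lra.
have small : L%:R * (17 / 18) ^+ (16 * s) <= 5^-1 :> R.
  rewrite exprM; apply: (@le_trans _ _ (L%:R * 2^-1 ^+ s)).
    by rewrite ler_wpM2l // lerXn2r // nnegrE ?exprn_ge0 ?divr_ge0 ?invr_ge0.
  rewrite exprVn ler_pdivrMr ?exprn_gt0 //.
  have : 8 * L%:R <= 2 ^+ s :> R by rewrite -natrX -natrM ler_nat.
  by have : 0 <= L%:R :> R by []; lra.
have [t mixt let_n] : exists2 t,
    is_sep_mixing_time (block_walk R k) (@uniform_distr R p) (1 / 2) t
    & (t <= 16 * s * L)%N.
  (* The separation lemmas take the modulus in the form [p'.+2]. *)
  case: p k oddp le3p @L @s L0 s0 ltpL sL small => [|[|p]] // k oddp le3p L s.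
  move=> L0 s0 ltpL sL small; apply: is_sep_mixing_time_exists.
  by apply: separated_within_half => //; rewrite muln_gt0.
exists t => //.
apply: (@le_trans _ _ (16 * s * L)%:R); first by rewrite ler_nat.
have lnp : ln 3 <= ln p%:R :> R.
  by rewrite ler_ln ?posrE ?ler_nat ?ltr0n //; lia.
have llp : ln (ln 3) <= ln (ln p%:R) :> R by rewrite ler_ln ?posrE //; lra.
have leL : L%:R <= 3 * ln p%:R :> R.
  have : L%:R <= 1 + 2 * ln p%:R :> R by apply: up_log2_le; rewrite ltnW.
  by lra.
have les : s%:R <= K * ln (ln p%:R) :> R.
  have : s%:R <= 1 + 2 * ln (8 * L)%:R :> R by apply: up_log2_le; lia.
  (* Here 8 L <= 24 ln p, from L <= 3 ln p. *)
  have : ln (8 * L)%:R <= ln 24 + ln (ln p%:R) :> R.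
    rewrite -lnM ?posrE //; last by lra.
    rewrite ler_ln ?posrE ?ltr0n ?muln_gt0 //; last by rewrite mulr_gt0 //; lra.
    by rewrite natrM; lra.
  have ln24 : 0 <= ln 24 :> R by rewrite ln_ge0 // ler1n.
  have : 1 + 2 * ln 24 <= (1 + 2 * ln 24) / ln (ln 3) * ln (ln p%:R) :> R.
    rewrite -mulrA ler_peMr //; first by lra.
    by rewrite mulrC ler_pdivlMr // mul1r.
  by rewrite /K; lra.
rewrite !natrM.
have -> : 48 * K * ln p%:R * ln (ln p%:R) =
  16 * (K * ln (ln p%:R)) * (3 * ln p%:R) :> R by ring.
by apply: ler_pM; rewrite ?mulr_ge0 // ler_wpM2l.
Qed.
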